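(* Consider a $[pqrs]$ random walk on $(-\infty,\infty)$ started in $i_0=0$, so that the probability of absorption in state $n$ is $s\,x_n$. Let $p,q>0$ be fixed with $p+q<1$ and let $s\to0^+$ with $r=1-p-q-s$. If $p>q$, then for each fixed integer $n$ $$s x_n=\frac{s}{p-q}\left\{1-\left[\frac{n}{p-q}+\frac{p+q}{(p-q)^2}\right]s+o(s)\right\}\quad(n\ge0),$$ $$s x_n=\frac{(p/q)^n s}{p-q}\left\{1-\left[\frac{-n}{p-q}+\frac{p+q}{(p-q)^2}\right]s+o(s)\right\}\quad(n\le0),$$ and $$\sum_{n=-\infty}^{-1}s x_n=\frac{qs}{(p-q)^2}\left\{1-\frac{2p+q}{(p-q)^2}s+o(s)\right\},\qquad \sum_{n=1}^{\infty}s x_n=1-\frac{ps}{(p-q)^2}+o(s).$$ If $p=q$, then $$\sum_{n=1}^{\infty}s x_n=\sum_{n=-\infty}^{-1}s x_n=\frac12-\frac14\sqrt{\frac sp}+o(\sqrt s),\qquad s x_0=\frac12\sqrt{\frac sp}+o(\sqrt s).$$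
   Context: Let $p,q,s>0$, $r\ge0$ with $p+q+r+s=1$. A $[pqrs]$ random walk on $(-\infty,\infty)$, i.e. on $\mathbb{Z}$: in each state $n$, at each time unit the walk moves to $n+1$ with probability $p$, moves to $n-1$ with probability $q$, stays in $n$ for a time unit with probability $r$, and with probability $s$ is absorbed in the current state $n$ (the process terminates there). $x_n$ denotes the expected number of visits to state $n$ when starting in $i_0$ (time $0$ counted). *)

(* Defs.v *)
From HB Require Import structures.
From mathcomp Require Import all_boot all_order all_algebra.
From mathcomp Require Import all_classical all_reals all_analysis.

Set Implicit Arguments.
Unset Strict Implicit.
Unset Printing Implicit Defensive.

Import Order.TTheory GRing.Theory Num.Theory.
Import numFieldNormedType.Exports.

Local Open Scope classical_set_scope.
Local Open Scope ring_scope.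

(* [Absorbed n]: the walk has been absorbed in [n]; the cemetery remembers the
   state in which the walk terminated. *)
Inductive walk_state : Type :=
  | Alive of int
  | Absorbed of int.

Definition walk_kernel (R : realType) (p q r s : R) (a b : walk_state) : R :=
  match a, b with
  | Alive n, Alive m =>
      if m == n + 1 then p else if m == n - 1 then q
      else if m == n then r else 0
  | Alive n, Absorbed m => if m == n then s else 0
  | Absorbed _, Alive _ => 0
  | Absorbed n, Absorbed m => if m == n then 1 else 0
  end.

(* [X] is a Markov chain with transition probabilities [walk_kernel] started
   in [Alive i0]. [walk_state] is countable and carries the discrete
   sigma-algebra, so measurability is required on singletons only; the Markov
   property is in product form, which avoids conditioning on null events. *)
Record pqrs_walk (R : realType) (p q r s : R) (i0 : int)
    (d : measure_display) (T : measurableType d) (P : probability T R)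
    (X : nat -> T -> walk_state) : Prop := {
  walk_measurable : forall (t : nat) (a : walk_state),
    measurable [set w | X t w = a] ;
  walk_start : P [set w | X 0%N w = Alive i0] = 1%E ;
  walk_markov : forall (t : nat) (a : nat -> walk_state),
    P [set w | forall i : nat, (i <= t.+1)%N -> X i w = a i] =
    (P [set w | forall i : nat, (i <= t)%N -> X i w = a i] *
       (walk_kernel p q r s (a t) (a t.+1))%:E)%E }.

(* Each time unit spent in [n] before absorption, time 0 included, is a visit;
   the time units following absorption in [n] are not. *)
Definition expected_visits (R : realType) (d : measure_display)
    (T : measurableType d) (P : probability T R) (X : nat -> T -> walk_state)
    (n : int) : \bar R :=
  (\int[P]_w \sum_(0 <= t <oo) (\1_[set u | X t u = Alive n] w)%:E)%E.

(* Main.v *)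
Require Import Defs.
From HB Require Import structures.
From mathcomp Require Import all_boot all_order all_algebra.
From mathcomp Require Import all_classical all_reals all_analysis.
From mathcomp Require Import measurable_realfun.
From mathcomp Require Import ring lra zify.

Set Implicit Arguments.
Unset Strict Implicit.
Unset Printing Implicit Defensive.

Import Order.TTheory GRing.Theory Num.Theory.
Import numFieldNormedType.Exports.

Local Open Scope classical_set_scope.
Local Open Scope ring_scope.

(** Let [u_t n] be the probability that the walk is alive in [n] at time [t].
    The Markov property gives the forward equation
    [u_(t+1) n = p u_t (n-1) + q u_t (n+1) + r u_t n] ([alive_probS]), and it
    gives that the probability of being absorbed in [n] grows by [s * u_t n] at
    time [t] ([absorbed_probS]).  So the probability of having been absorbed in
    [n] by time [N] is [s] times the expected number of visits to [n] before
    [N].  Letting [N] tend to infinity yields the identity between absorption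
    probabilities and expected visits ([absorption_prob]), and also the bound
    [s * x_n <= 1]: the expected numbers of visits [x_n] are finite and bounded
    in [n].

    Summing the forward equation over time, [x] is a bounded solution of
    [(p + q + s) x_n = delta_(n,0) + p x_(n-1) + q x_(n+1)].  There is only one
    such solution, because a bounded solution of the homogeneous equation is
    contracted by the factor [(p + q) / (p + q + s) < 1]
    ([bounded_harmonic_eq0]).  It can therefore be guessed: with
    [D = sqrt ((p + q + s)^2 - 4 p q)] it is [a^n / D] for [n >= 0] and
    [b^|n| / D] for [n <= 0], where [a = (p + q + s - D) / 2q] and
    [b = (p + q + s - D) / 2p] lie strictly between 0 and 1
    ([expected_visits_green]).  Summing the two geometric series, and using
    [D^2 = (p + s - q)^2 + 4 q s] to cancel denominators, the masses absorbed
    to the right and to the left of the origin are [(D + p - q - s) / 2D] and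
    [(D + q - p - s) / 2D] ([green_right_sum], [green_left_sum]).

    What remains is calculus at [s = 0].  For [q < p] the function [D] is
    differentiable there, with value [p - q] and derivative
    [(p + q) / (p - q)], so that every expansion is a first-order Taylor
    formula ([is_derive_littleo]).  The left mass is of order [s] and has to be
    known up to [o(s^2)]; writing it as [2 q s / (D (D + p - q + s))] takes the
    vanishing factor out and leaves a function that again needs only one
    derivative.  For [p = q] one has [s / D = sqrt s / sqrt (s + 4 p)], and
    continuity of [1 / sqrt (s + 4 p)] at 0 suffices. *)

(** * Countably many states *)

Definition walk_state_code (a : walk_state) : int + int :=
  match a with Alive n => inl n | Absorbed n => inr n end.

Definition walk_state_decode (c : int + int) : walk_state :=
  match c with inl n => Alive n | inr n => Absorbed n end.

Lemma walk_state_codeK : cancel walk_state_code walk_state_decode.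
Proof. by case. Qed.

HB.instance Definition _ :=
  Countable.copy walk_state (can_type walk_state_codeK).

Lemma eq_Alive (m n : int) : (Alive m == Alive n) = (m == n).
Proof. by apply/eqP/eqP => [[]|->]. Qed.

Section CountablePartition.
Context (R : realType) (d : measure_display) (T : measurableType d).
Context (P : probability T R) (Y : T -> walk_state).
Hypothesis mY : forall a, measurable [set w | Y w = a].

(** The cells [Y = a] form a countable partition, so a proportionality that
    holds on every cell sums to the whole event.  It carries both the
    marginalization of path probabilities and, with [c = 0], the fact that an
    event which is null on every cell is null. *)
Lemma measure_scale_by_state (A B : set T) (c : R) :
  0 <= c -> measurable A -> measurable B ->
  (forall a, P (A `&` [set w | Y w = a]) =
             (P (B `&` [set w | Y w = a]) * c%:E)%E) ->
  P A = (P B * c%:E)%E.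
Proof.
move=> c0 mA mB AB.
(* The codes that decode to no state index empty cells. *)
pose cell k := [set w | pickle_inv k = Some (Y w)].
have cellE k : cell k =
    if pickle_inv k is Some a then [set w | Y w = a] else set0.
  rewrite /cell; case: (pickle_inv k) => [a|]; apply/seteqP; split=> w //=.
  - by case.
  - by move=> ->.
have mcell k : measurable (cell k).
  by rewrite cellE; case: (pickle_inv k).
have part C : measurable C -> P C = (\sum_(0 <= k <oo) P (C `&` cell k))%E.
  move=> mC.
  have {1}-> : C = \bigcup_k (C `&` cell k).
    apply/seteqP; split=> [w Cw|w [k _ []]//].
    by exists (pickle (Y w)) => //; split=> //; rewrite /cell/= pickleK_inv.
  apply: measure_semi_bigcup.
  - by move=> k; apply: measurableI.
  - apply/trivIsetP => i j _ _ ij; apply/seteqP; split=> w //= [[_]].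
    rewrite /cell/= => ei [_ ej].
    have := @pickle_invK walk_state i; have := @pickle_invK walk_state j.
    rewrite /oapp ei ej => ji ii.
    by move: ij; rewrite -ji -ii eqxx.
  - by apply: bigcupT_measurable => k; apply: measurableI.
rewrite (part _ mA) (part _ mB) muleC -nneseriesZl//.
apply: eq_eseriesr => k _; rewrite cellE muleC.
by case: (pickle_inv k) => [a|]; [exact: AB|rewrite !setI0 !measure0 mul0e].
Qed.

(** Stated for the coercion of a probability, so that it can be used for
    rewriting; the general law is about contents. *)
Lemma probability_split (A B : set T) : measurable A -> measurable B ->
  P A = (P (A `\` B) + P (A `&` B))%E.
Proof. exact: measureDI. Qed.

(** Turns the countable sum over states into the finite sum over the possible
    predecessors of a state. *)
Lemma probability_finite_states (L : seq walk_state) (A : set T) :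
  uniq L -> measurable A ->
  (forall a, a \notin L -> P (A `&` [set w | Y w = a]) = 0%E) ->
  P A = (\sum_(a <- L) P (A `&` [set w | Y w = a]))%E.
Proof.
elim: L A => [|a L IH] A /=.
  move=> _ mA A0; rewrite big_nil.
  by rewrite (@measure_scale_by_state A A 0) ?mule0// => a; rewrite A0// mule0.
move=> /andP[aL uL] mA A0; rewrite big_cons.
rewrite (probability_split mA (mY a)) addeC; congr (_ + _)%E.
have sub b : b != a ->
    (A `\` [set w | Y w = a]) `&` [set w | Y w = b] = A `&` [set w | Y w = b].
  move=> ba; apply/seteqP; split=> w /= [].
    by move=> [].
  by move=> Aw Yb; split=> //; split=> // Ya; move: ba; rewrite -Ya -Yb eqxx.
have mD : measurable (A `\` [set w | Y w = a]) by apply: measurableD.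
rewrite (IH _ uL mD); last first.
  move=> b bL; have [->|ba] := eqVneq b a.
    by rewrite setDKI measure0.
  by rewrite sub// A0// inE negb_or ba.
rewrite big_seq [RHS]big_seq; apply: eq_bigr => b bL; rewrite sub//.
by apply: contraNneq aL => <-.
Qed.

End CountablePartition.

(** * The law of the walk *)

Lemma walk_kernel_ge0 (R : realType) (p q r s : R) (a b : walk_state) :
  0 <= p -> 0 <= q -> 0 <= r -> 0 <= s -> 0 <= walk_kernel p q r s a b.
Proof. by case: a b => m [] n //= *; repeat case: ifP => // _. Qed.

Section WalkLaw.
Context (R : realType) (p q r s : R) (d : measure_display).
Context (T : measurableType d) (P : probability T R) (X : nat -> T -> walk_state).
Hypotheses (p0 : 0 <= p) (q0 : 0 <= q) (r0 : 0 <= r) (s0 : 0 <= s).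
Hypothesis hX : pqrs_walk p q r s 0 P X.

Local Notation at_ t a := [set w | X t w = a].
Let mX := walk_measurable hX.

Lemma measurable_path (j t : nat) (a : nat -> walk_state) :
  measurable [set w | forall i, (j <= i <= t)%N -> X i w = a i].
Proof.
have -> : [set w | forall i, (j <= i <= t)%N -> X i w = a i] =
    \bigcap_(i in [set i | (j <= i <= t)%N]) at_ i (a i) by [].
by apply: bigcap_measurableType => i _; apply: mX.
Qed.

(** The Markov property is given for full histories from time 0; the beginning
    of the history is summed out one time unit after the other. *)
Lemma path_law (j t : nat) (a : nat -> walk_state) : (j <= t)%N ->
  P [set w | forall i, (j <= i <= t.+1)%N -> X i w = a i] =
  (P [set w | forall i, (j <= i <= t)%N -> X i w = a i] *
     (walk_kernel p q r s (a t) (a t.+1))%:E)%E.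
Proof.
elim: j a => [|j IH] a jt; first exact: walk_markov hX t a.
apply: (measure_scale_by_state (mX j)) => [|||b]; try exact: measurable_path.
  exact: walk_kernel_ge0.
(* Fixing the state at time [j] to [b] prolongs the path backwards. *)
pose a' i := if i == j then b else a i.
have ext n : (j <= n)%N ->
    [set w | forall i, (j < i <= n)%N -> X i w = a i] `&` at_ j b =
    [set w | forall i, (j <= i <= n)%N -> X i w = a' i].
  move=> jn; apply/seteqP; split=> w /=.
    move=> [H Xj] i /andP[ji iN]; rewrite /a'; case: eqVneq => [->//|ij].
    by apply: H; rewrite iN ltn_neqAle eq_sym ij ji.
  move=> H; split.
    move=> i /andP[ji iN]; rewrite H ?(ltnW ji)// /a'.
    by rewrite gtn_eqF.
  by rewrite H ?leqnn// /a' eqxx.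
rewrite !ext ?(ltnW jt)//; last by rewrite ltnW// ltnW.
rewrite IH ?(ltnW jt)//.
by rewrite /a' !gtn_eqF// ltnW.
Qed.

Lemma two_step_law (t : nat) (a b : walk_state) :
  P (at_ t.+1 b `&` at_ t a) = (P (at_ t a) * (walk_kernel p q r s a b)%:E)%E.
Proof.
pose f i := if i == t then a else b.
have := @path_law t t f (leqnn t); rewrite /f eqxx gtn_eqF//.
congr (P _ = (P _ * _)%E); apply/seteqP; split=> w /=.
- move=> H; split; first by rewrite H ?leqnn ?leqnSn// gtn_eqF.
  by rewrite H ?leqnn ?leqnSn// eqxx.
- move=> [Xb Xa] i; rewrite -ltnS -(ltnS i) !ltnS => /andP[ti it].
  case: eqVneq => [->//|it'].
  suff -> : i = t.+1 by [].
  by apply/eqP; rewrite eqn_leq it ltn_neqAle eq_sym it' ti.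
- by move=> H; rewrite H ?leqnn// eqxx.
- move=> Xa i ti; have -> : i = t by apply/eqP; rewrite eqn_leq andbC.
  by rewrite eqxx.
Qed.

(** Chapman-Kolmogorov for one step, [L] being the list of predecessors of
    [b]. *)
Lemma forward_equation (L : seq walk_state) (t : nat) (b : walk_state) :
  uniq L -> (forall a, a \notin L -> walk_kernel p q r s a b = 0) ->
  P (at_ t.+1 b) =
  (\sum_(a <- L) P (at_ t a) * (walk_kernel p q r s a b)%:E)%E.
Proof.
move=> uL KL; rewrite (probability_finite_states (mX t) uL)//.
  by apply: eq_bigr => a _; rewrite two_step_law.
by move=> a aL; rewrite two_step_law KL// mule0.
Qed.

Definition alive_prob (t : nat) (n : int) : R := fine (P (at_ t (Alive n))).

Lemma alive_probE t n : P (at_ t (Alive n)) = (alive_prob t n)%:E.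
Proof. by rewrite fineK// fin_num_measure. Qed.

Lemma alive_prob_ge0 t n : 0 <= alive_prob t n.
Proof. exact: fine_ge0. Qed.

Lemma initial_law (a : walk_state) : P (at_ 0%N a) = (a == Alive 0)%:R%:E.
Proof.
have [->|a0] := eqVneq; first exact: walk_start hX.
apply/eqP; rewrite eq_le measure_ge0 andbT.
have : (P (at_ 0%N a `|` at_ 0%N (Alive 0)) <= 1)%E.
  by apply: probability_le1; apply: measurableU.
have -> : P (at_ 0%N a `|` at_ 0%N (Alive 0)) =
    (P (at_ 0%N a) + P (at_ 0%N (Alive 0)))%E.
  apply: measureU => //; apply/seteqP; split=> w //= [-> e].
  by move: a0; rewrite e eqxx.
by rewrite (walk_start hX) -leeBrDr// subee.
Qed.

Lemma alive_prob0 n : alive_prob 0 n = (n == 0)%:R.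
Proof. by rewrite /alive_prob initial_law eq_Alive. Qed.

Lemma alive_probS t n : alive_prob t.+1 n =
  p * alive_prob t (n - 1) + q * alive_prob t (n + 1) + r * alive_prob t n.
Proof.
have e1 : (n - 1 == n) = false by lia.
have e2 : (n + 1 == n) = false by lia.
have e3 : (n - 1 == n + 1) = false by lia.
apply: EFin_inj; rewrite -alive_probE.
rewrite (@forward_equation [:: Alive (n - 1); Alive (n + 1); Alive n]).
- rewrite !big_cons big_nil adde0 !alive_probE.
  rewrite /walk_kernel subrK eqxx addrK.
  rewrite [n == n + 1 + 1]negbTE ?eqxx; last by lia.
  rewrite [n == n + 1]eq_sym e2 [n == n - 1]eq_sym e1 -!EFinM -!EFinD.
  by congr EFin; ring.
- by rewrite /= !inE !eq_Alive e1 e2 e3.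
- case=> m //=; rewrite !inE !eq_Alive !negb_or => /and3P[m1 m2 m3].
  by rewrite !ifF//; apply/negbTE; move: m1 m2 m3; lia.
Qed.

(** The absorbed state [n] is entered only from [n] alive, and never left. *)
Lemma absorbed_probS t n : P (at_ t.+1 (Absorbed n)) =
  (P (at_ t (Absorbed n)) + (s * alive_prob t n)%:E)%E.
Proof.
rewrite (@forward_equation [:: Absorbed n; Alive n])//.
  by rewrite !big_cons big_nil adde0/= eqxx mule1 alive_probE -EFinM mulrC.
case=> m; rewrite !inE /= ?negb_or.
  by move=> m1; rewrite ifF//; apply/negbTE; apply: contraNneq m1 => ->.
move=> /andP[m1 _]; rewrite ifF//.
by apply/negbTE; apply: contraNneq m1 => ->.
Qed.

Lemma absorbed_probE t n : P (at_ t (Absorbed n)) =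
  (s * \sum_(0 <= i < t) alive_prob i n)%:E.
Proof.
elim: t => [|t IH]; first by rewrite initial_law big_nil mulr0.
by rewrite absorbed_probS IH big_nat_recr//= mulrDr.
Qed.

(** Being absorbed in [n] at time [t] is, up to a null event, increasing in [t]:
    the event differs by a null set from absorption at some time up to [t], to
    which continuity from below applies. *)
Lemma cvg_absorbed_prob n :
  (P (at_ t (Absorbed n)) @[t --> \oo] -->
   P [set w | exists t, X t w = Absorbed n])%classic.
Proof.
pose U t := [set w | exists2 i, (i <= t)%N & X i w = Absorbed n].
have US t : U t.+1 = U t `|` at_ t.+1 (Absorbed n).
  apply/seteqP; split=> w /=.
    move=> [i]; rewrite leq_eqVlt => /orP[/eqP ->|it] Xi; first by right.
    by left; exists i.
  by move=> [[i it Xi]|Xt]; [exists i => //; exact: leqW|exists t.+1].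
have U0 : U 0%N = at_ 0%N (Absorbed n).
  apply/seteqP; split=> w /=; last by move=> ?; exists 0%N.
  by move=> [i]; rewrite leqn0 => /eqP ->.
have mU t : measurable (U t).
  by elim: t => [|t IH]; rewrite ?U0 ?US//; apply: measurableU.
have PU t : P (U t) = P (at_ t (Absorbed n)).
  have sU : at_ t (Absorbed n) `<=` U t by move=> w ?; exists t.
  suff D0 : P (U t `\` at_ t (Absorbed n)) = 0%E.
    rewrite (probability_split P (mU t) (mX t (Absorbed n))) D0 add0e.
    by congr (P _); apply/setIidPr.
  elim: t {sU} => [|t IH]; first by rewrite U0 setDv measure0.
  rewrite US setDUl setDv setU0; apply/eqP; rewrite eq_le measure_ge0 andbT.
  pose V1 := U t `\` at_ t (Absorbed n).
  pose V2 := at_ t (Absorbed n) `\` at_ t.+1 (Absorbed n).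
  have mV1 : measurable V1 by apply: measurableD.
  have mV2 : measurable V2 by apply: measurableD.
  apply: (@le_trans _ _ (P (V1 `|` V2))).
    apply: le_measure; rewrite ?inE.
    - exact: measurableD.
    - exact: measurableU.
    - move=> w [Uw Xw]; have [Xt|Xt] := pselect (X t w = Absorbed n).
        by right.
      by left.
  have le12 : (P (V1 `|` V2) <= P V1 + P V2)%E by apply: measureU2.
  apply: (le_trans le12).
  have -> : P V2 = 0%E.
    have := probability_split P (mX t (Absorbed n)) (mX t.+1 (Absorbed n)).
    rewrite [_ `&` _]setIC two_step_law /= eqxx mule1 => E.
    have fin : P (at_ t (Absorbed n)) \is a fin_num by apply: fin_num_measure.
    have := congr1 (fun x => x - P (at_ t (Absorbed n)))%E E.
    by rewrite addeK// subee// => <-.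
  by rewrite [P V1]IH adde0.
have -> : [set w | exists t, X t w = Absorbed n] = \bigcup_t U t.
  apply/seteqP; split=> w /=; first by move=> [t Xt]; exists t => //; exists t.
  by move=> [t _ [i _ Xi]]; exists i.
under eq_fun do rewrite -PU.
apply: nondecreasing_cvg_mu => //; first exact: bigcupT_measurable.
move=> i j ij; apply/subsetPset => w [k ki Xk]; exists k => //.
exact: leq_trans ij.
Qed.

Lemma expected_visits_series n :
  expected_visits P X n = (\sum_(0 <= t <oo) (alive_prob t n)%:E)%E.
Proof.
rewrite /expected_visits integral_nneseries//.
  apply: eq_eseriesr => t _; rewrite integral_indic// setIT.
  exact: alive_probE.
by move=> t; apply/measurable_EFinP; exact: measurable_indic.
Qed.

Definition visits_upto (N : nat) (n : int) : R :=
  \sum_(0 <= t < N) alive_prob t n.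

Lemma visits_upto_ge0 N n : 0 <= visits_upto N n.
Proof. by apply: sumr_ge0 => t _; apply: alive_prob_ge0. Qed.

Lemma visits_uptoS N n : visits_upto N.+1 n =
  (n == 0)%:R + p * visits_upto N (n - 1) + q * visits_upto N (n + 1) +
  r * visits_upto N n.
Proof.
rewrite /visits_upto big_nat_recl//= alive_prob0 -!addrA.
congr (_ + _); under eq_bigr do rewrite alive_probS.
by rewrite !big_split/= -!mulr_sumr addrA.
Qed.

(** The left-hand side is the probability of being absorbed in [n] at time
    [N]; this a priori bound makes the expected numbers of visits finite. *)
Lemma visits_upto_le N n : s * visits_upto N n <= 1.
Proof.
rewrite -lee_fin -absorbed_probE; exact: probability_le1.
Qed.

Hypothesis s_gt0 : 0 < s.

Definition mean_visits (n : int) : R := limn (visits_upto ^~ n).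

Lemma cvg_visits_upto n : visits_upto ^~ n @ \oo --> mean_visits n.
Proof.
apply: nondecreasing_is_cvgn.
  apply/nondecreasing_seqP => N; rewrite /visits_upto big_nat_recr//=.
  by rewrite lerDl; apply: alive_prob_ge0.
exists s^-1 => _ [N _ <-]; rewrite -[leRHS]mulr1 ler_pdivlMl//.
exact: visits_upto_le.
Qed.

Lemma mean_visits_ge0 n : 0 <= mean_visits n.
Proof.
apply: (cvgr_to_ge (cvg_visits_upto (n := n))).
by apply: nearW => N; apply: visits_upto_ge0.
Qed.

Lemma mean_visits_le n : mean_visits n <= s^-1.
Proof.
apply: (cvgr_to_le (cvg_visits_upto (n := n))).
apply: nearW => N; rewrite -[leRHS]mulr1 ler_pdivlMl//.
exact: visits_upto_le.
Qed.

Lemma mean_visits_rec n : mean_visits n =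
  (n == 0)%:R + p * mean_visits (n - 1) + q * mean_visits (n + 1) +
  r * mean_visits n.
Proof.
have c1 : (fun N => visits_upto N.+1 n) @ \oo --> mean_visits n.
  by have := cvg_visits_upto (n := n); rewrite -cvg_shiftS.
apply: (cvg_unique _ c1) => //.
rewrite (_ : (fun N => visits_upto N.+1 n) = fun N =>
    (n == 0)%:R + p * visits_upto N (n - 1) + q * visits_upto N (n + 1) +
    r * visits_upto N n); last by apply/funext => N; rewrite visits_uptoS.
by apply: cvgD; [apply: cvgD; [apply: cvgD; [exact: cvg_cst|]|]|];
  apply: cvgM; (exact: cvg_cst || exact: cvg_visits_upto).
Qed.

Lemma expected_visitsE n : expected_visits P X n = (mean_visits n)%:E.
Proof.
rewrite expected_visits_series; apply: cvg_lim => //.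
rewrite [X in X @ _ --> _](_ : _ = EFin \o (visits_upto ^~ n)); last first.
  by apply/funext => N /=; rewrite sumEFin.
apply: cvg_EFin; first exact: nearW.
exact: cvg_visits_upto.
Qed.

Lemma absorption_prob n :
  P [set w | exists t, X t w = Absorbed n] = (s%:E * expected_visits P X n)%E.
Proof.
have -> : (s%:E * expected_visits P X n)%E = (s * mean_visits n)%:E.
  by rewrite expected_visitsE EFinM.
have lim_s : (s * visits_upto N n)%:E @[N --> \oo] --> (s * mean_visits n)%:E.
  apply: cvg_EFin; first exact: nearW.
  by apply: cvgM; [exact: cvg_cst|exact: cvg_visits_upto].
apply: (cvg_unique _ (cvg_absorbed_prob (n := n))) => //.
rewrite (_ : (fun t => _) = fun N => (s * visits_upto N n)%:E)//.
by apply/funext => N; rewrite absorbed_probE.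
Qed.

End WalkLaw.

(** * The bounded solution of the visit equation *)

Section GreenFunction.
Context (R : realType).
Implicit Types p q s : R.

(** The square root of the discriminant of [q z^2 - (p + q + s) z + p], the
    characteristic polynomial of the visit equation. *)
Definition discr_root p q s : R := Num.sqrt ((p + q + s) ^+ 2 - 4 * p * q).

(** The smaller root of that polynomial; exchanging [p] and [q] gives the decay
    rate on the other side of the origin. *)
Definition decay p q s : R := (p + q + s - discr_root p q s) / (2 * q).

Definition green p q s (n : int) : R :=
  match n with
  | Posz k => decay p q s ^+ k / discr_root p q s
  | Negz k => decay q p s ^+ k.+1 / discr_root p q s
  end.

Lemma discr_rootC p q s : discr_root q p s = discr_root p q s.
Proof. by rewrite /discr_root; congr Num.sqrt; ring. Qed.

Lemma greenN p q s (n : int) : green q p s (- n) = green p q s n.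
Proof.
case: n => [[|k]|k]; first by rewrite oppr0 /green !expr0 discr_rootC.
  by rewrite -NegzE /green discr_rootC.
by rewrite NegzE opprK /green discr_rootC.
Qed.

Lemma discr_rootK p q s : 0 < p -> 0 < q -> 0 < s ->
  discr_root p q s ^+ 2 = (p + q + s) ^+ 2 - 4 * p * q.
Proof.
move=> p0 q0 s0; rewrite sqr_sqrtr//.
have -> : (p + q + s) ^+ 2 - 4 * p * q = (p + s - q) ^+ 2 + 4 * q * s by ring.
by rewrite addr_ge0 ?sqr_ge0// !mulr_ge0 ?ltW.
Qed.

(** The excess of the squares is [4 q s]. Applied to [p, q] and to [q, p], this
    bound places both decay rates below 1. *)
Lemma discr_root_gt p q s : 0 < p -> 0 < q -> 0 < s ->
  `|p + s - q| < discr_root p q s.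
Proof.
move=> p0 q0 s0; rewrite -(@ltr_pXn2r _ 2) ?nnegrE ?sqrtr_ge0//.
rewrite discr_rootK// -normrX ger0_norm ?sqr_ge0// -subr_gt0.
have -> : (p + q + s) ^+ 2 - 4 * p * q - (p + s - q) ^+ 2 = 4 * q * s by ring.
by rewrite !mulr_gt0.
Qed.

Lemma discr_root_gt0 p q s : 0 < p -> 0 < q -> 0 < s -> 0 < discr_root p q s.
Proof. by move=> p0 q0 s0; apply: le_lt_trans (discr_root_gt p0 q0 s0). Qed.

Lemma decay_gt0 p q s : 0 < p -> 0 < q -> 0 < s -> 0 < decay p q s.
Proof.
move=> p0 q0 s0; rewrite divr_gt0 ?mulr_gt0// subr_gt0.
rewrite -(@ltr_pXn2r _ 2) ?nnegrE ?sqrtr_ge0 ?addr_ge0 ?ltW//.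
by rewrite discr_rootK// gtrBl !mulr_gt0.
Qed.

Lemma decay_lt1 p q s : 0 < p -> 0 < q -> 0 < s -> decay p q s < 1.
Proof.
move=> p0 q0 s0; rewrite ltr_pdivrMr ?mulr_gt0//.
by have := discr_root_gt p0 q0 s0; rewrite ltr_norml => /andP[_]; lra.
Qed.

Lemma decay_root p q s : 0 < p -> 0 < q -> 0 < s ->
  p + q * decay p q s ^+ 2 = (p + q + s) * decay p q s.
Proof.
move=> p0 q0 s0; have q2 := lt0r_neq0 q0.
have E : decay p q s * (2 * q) = p + q + s - discr_root p q s.
  by rewrite /decay divfK// mulf_neq0.
have DE : discr_root p q s = p + q + s - decay p q s * (2 * q) by rewrite E; ring.
have := discr_rootK p0 q0 s0; rewrite {1}DE => H.
apply: (mulfI q2); apply: (@mulfI _ 4) => //; lra.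
Qed.

(** Away from the origin this is the characteristic equation of the decay rate;
    at the origin, the normalization by [discr_root] produces the unit source. *)
Lemma green_rec p q s (n : int) : 0 < p -> 0 < q -> 0 < s ->
  (p + q + s) * green p q s n =
  (n == 0)%:R + p * green p q s (n - 1) + q * green p q s (n + 1).
Proof.
move=> p0 q0 s0; have D0 := lt0r_neq0 (discr_root_gt0 p0 q0 s0).
have pos k : (p + q + s) * green p q s (Posz k.+1) =
    p * green p q s (Posz k.+1 - 1) + q * green p q s (Posz k.+1 + 1).
  have -> : Posz k.+1 - 1 = Posz k by lia.
  have -> : Posz k.+1 + 1 = Posz k.+2 by lia.
  transitivity ((p + q + s) * decay p q s *
      (decay p q s ^+ k / discr_root p q s)); rewrite /= ?exprS; first by ring.
  by rewrite -decay_root// !exprS; ring.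
have neg k : (p + q + s) * green p q s (Negz k) =
    p * green p q s (Negz k - 1) + q * green p q s (Negz k + 1).
  have -> : Negz k - 1 = Negz k.+1 by lia.
  have -> : green p q s (Negz k + 1) = decay q p s ^+ k / discr_root p q s.
    by case: k => [|k]; [rewrite expr0|have -> : Negz k.+1 + 1 = Negz k by lia].
  transitivity ((q + p + s) * decay q p s *
      (decay q p s ^+ k / discr_root p q s)); rewrite /= ?exprS; first by ring.
  by rewrite -decay_root// !exprS; ring.
case: n => [[|k]|k]; [|by rewrite pos//= add0r|by rewrite neg//= add0r].
rewrite /= expr0 expr1 /decay discr_rootC.
by field; rewrite discr_rootC D0 !lt0r_neq0.
Qed.

Lemma green_ge0 p q s n : 0 < p -> 0 < q -> 0 < s -> 0 <= green p q s n.
Proof.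
move=> p0 q0 s0; case: n => k /=;
  by rewrite divr_ge0 ?exprn_ge0 ?ltW// ?decay_gt0 ?discr_root_gt0.
Qed.

Lemma green_le p q s n : 0 < p -> 0 < q -> 0 < s ->
  green p q s n <= (discr_root p q s)^-1.
Proof.
move=> p0 q0 s0; have D0 := discr_root_gt0 p0 q0 s0.
case: n => k /=; rewrite ler_piMl ?invr_ge0 ?(ltW D0)//;
  by rewrite exprn_ile1 ?ltW ?decay_gt0 ?decay_lt1.
Qed.

(** Killing makes the averaging operator a contraction: a bound [M] on a bounded
    solution improves to [M * (p + q) / (p + q + s)], and so on down to 0. *)
Lemma bounded_harmonic_eq0 p q s (y : int -> R) (M : R) :
  0 < p -> 0 < q -> 0 < s -> (forall n, `|y n| <= M) ->
  (forall n, (p + q + s) * y n = p * y (n - 1) + q * y (n + 1)) ->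
  forall n, y n = 0.
Proof.
move=> p0 q0 s0 yM yE n; pose rho := (p + q) / (p + q + s).
have c0 : 0 < p + q + s by rewrite !addr_gt0.
have rho0 : 0 <= rho by rewrite divr_ge0 ?addr_ge0 ?ltW.
have rho1 : rho < 1 by rewrite ltr_pdivrMr// mul1r ltrDl.
have bound k m : `|y m| <= M * rho ^+ k.
  elim: k m => [|k IH] m; first by rewrite mulr1.
  rewrite -(ler_pM2l c0) -{1}[p + q + s]gtr0_norm// -normrM yE.
  have -> : (p + q + s) * (M * rho ^+ k.+1) = (p + q) * (M * rho ^+ k).
    rewrite exprS -[in RHS](@divfK _ (p + q + s) _ (p + q)) ?lt0r_neq0//.
    by rewrite -/rho; ring.
  apply: (le_trans (ler_normD _ _)).
  rewrite !normrM (gtr0_norm p0) (gtr0_norm q0) mulrDl.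
  by rewrite lerD// ler_pM2l.
apply/normr0_eq0/eqP; rewrite eq_le normr_ge0 andbT.
have cvg0 : geometric M rho @ \oo --> (0 : R).
  by apply: cvg_geometric; rewrite ger0_norm.
by apply: (cvgr_to_ge cvg0); apply: nearW => k; apply: bound.
Qed.

Lemma geometric_eseries (c a : R) : 0 <= a < 1 ->
  (\sum_(1 <= k <oo) (c * a ^+ k)%:E = (c * a / (1 - a))%:E)%E.
Proof.
move=> /andP[a0 a1]; apply: cvg_lim => //.
rewrite -(cvg_shiftS) /=.
rewrite (_ : (fun N => _) = EFin \o series (geometric (c * a) a)).
  apply: cvg_EFin; first exact: nearW.
  by apply: cvg_geometric_series; rewrite ger0_norm.
apply/funext => N /=; rewrite sumEFin /series /= big_add1 /=.
by congr EFin; apply: eq_bigr => k _; rewrite exprS mulrA.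
Qed.

(** The geometric sum is [s * a / ((1 - a) * D)] with [a] the decay rate, where
    [1 - a] vanishes to first order in [s] when [q < p]; the discriminant
    identity cancels that factor against [s]. *)
Lemma green_right_sum p q s : 0 < p -> 0 < q -> 0 < s ->
  (\sum_(1 <= k <oo) (s * green p q s k%:Z)%:E)%E =
  ((discr_root p q s + p - q - s) / (2 * discr_root p q s))%:E.
Proof.
move=> p0 q0 s0; have D0 := discr_root_gt0 p0 q0 s0.
have a0 := decay_gt0 p0 q0 s0; have a1 := decay_lt1 p0 q0 s0.
under eq_eseriesr do rewrite /= mulrCA mulrC.
rewrite geometric_eseries ?(ltW a0)//; congr EFin.
have nz : discr_root p q s + (q - p - s) != 0.
  have := discr_root_gt p0 q0 s0.
  by rewrite ltr_norml => /andP[? ?]; apply: lt0r_neq0; lra.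
have E := discr_rootK p0 q0 s0.
have -> : 1 - decay p q s = (discr_root p q s + (q - p - s)) / (2 * q).
  by rewrite /decay; field; rewrite lt0r_neq0.
rewrite /decay; set D := discr_root p q s in nz D0 E *.
apply/eqP; rewrite -subr_eq0.
(* The difference of both sides is a multiple of the discriminant identity. *)
suff -> : s / D * ((p + q + s - D) / (2 * q)) / ((D + (q - p - s)) / (2 * q)) -
  (D + p - q - s) / (2 * D) = - (D ^+ 2 - ((p + q + s) ^+ 2 - 4 * p * q)) /
   (2 * D * (D + (q - p - s))).
  by rewrite E subrr oppr0 mul0r.
by field; rewrite nz !lt0r_neq0.
Qed.

Lemma green_left_sum p q s : 0 < p -> 0 < q -> 0 < s ->
  (\sum_(1 <= k <oo) (s * green p q s (- k%:Z))%:E)%E =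
  ((discr_root p q s + q - p - s) / (2 * discr_root p q s))%:E.
Proof.
move=> p0 q0 s0; under eq_eseriesr do rewrite greenN.
by rewrite green_right_sum// discr_rootC.
Qed.

End GreenFunction.

(** * Expected visits in closed form *)

Section ExactSolution.
Context (R : realType) (p q s : R) (d : measure_display).
Context (T : measurableType d) (P : probability T R) (X : nat -> T -> walk_state).
Hypotheses (p_gt0 : 0 < p) (q_gt0 : 0 < q) (s_gt0 : 0 < s).
Hypothesis s_le : s <= 1 - p - q.
Hypothesis hX : pqrs_walk p q (1 - p - q - s) s 0 P X.

(** Both sides are bounded in [n] and solve the same inhomogeneous equation. *)
Lemma expected_visits_green n : expected_visits P X n = (green p q s n)%:E.
Proof.
have [p0 q0 s0] : [/\ 0 <= p, 0 <= q & 0 <= s] by rewrite !ltW.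
have r0 : 0 <= 1 - p - q - s by rewrite subr_ge0.
rewrite (expected_visitsE p0 q0 r0 s0 hX s_gt0); congr EFin.
apply/eqP; rewrite -subr_eq0; apply/eqP; move: n.
apply: (@bounded_harmonic_eq0 _ p q s _ (s^-1 + (discr_root p q s)^-1)) => // n.
  apply: (le_trans (ler_normB _ _)).
  rewrite (ger0_norm (mean_visits_ge0 p0 q0 r0 s0 hX s_gt0 n)).
  rewrite (ger0_norm (green_ge0 n p_gt0 q_gt0 s_gt0)) lerD// ?green_le//.
  exact: mean_visits_le p0 q0 r0 s0 hX s_gt0 n.
have := mean_visits_rec p0 q0 r0 s0 hX s_gt0 n.
have := green_rec n p_gt0 q_gt0 s_gt0.
lra.
Qed.

End ExactSolution.

(** * Expansions for small absorption probability *)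

Section SmallAbsorption.
Context (R : realType).
Implicit Types (p q : R) (f : R -> R).

Lemma is_derive_littleo f (df : R) : is_derive (0 : R) 1 f df ->
  (fun s => f s - f 0 - df * s) =o_ (0^'+) (fun s : R => s).
Proof.
move=> [fd fE]; apply/eqoP => eps eps0.
have cv : h^-1 *: (f (h *: 1 + 0) - f 0) @[h --> (0 : R)^'+] --> df.
  by apply: cvg_dnbhs_at_right; rewrite -fE; exact: fd.
move/cvgrPdist_le : cv => /(_ _ eps0); apply: filter_app; near=> s.
have s0 : 0 < s by [].
rewrite addr0 [s *: 1]mulr1 => H.
have -> : f s - f 0 - df * s = - (s * (df - s^-1 * (f s - f 0))).
  by rewrite mulrBr mulVKf ?lt0r_neq0//; ring.
by rewrite normrN normrM mulrC ler_wpM2r.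
Unshelve. all: by end_near. Qed.

Lemma cvg0_littleo_sqrt f : f s @[s --> (0 : R)^'+] --> (0 : R) ->
  (fun s => Num.sqrt s * f s) =o_ (0^'+) (fun s : R => Num.sqrt s).
Proof.
move=> f0; apply/eqoP => eps eps0.
move/cvgrPdist_le : f0 => /(_ _ eps0); apply: filter_app.
apply: nearW => s _; rewrite sub0r normrN normrM => H.
by rewrite mulrC ler_wpM2r.
Qed.

Lemma discr_root0 p q : q < p -> discr_root p q 0 = p - q.
Proof.
move=> qp; rewrite /discr_root.
have -> : (p + q + 0) ^+ 2 - 4 * p * q = (p - q) ^+ 2 by ring.
by rewrite sqrtr_sqr gtr0_norm// subr_gt0.
Qed.

Lemma is_derive_affine (a : R) : is_derive (0 : R) 1 (fun s => a + s) 1.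
Proof.
have := is_deriveD (is_derive_cst a (0 : R) 1) (is_derive_id (0 : R) 1).
by rewrite add0r.
Qed.

Lemma is_derive_discr_root p q : q < p ->
  is_derive (0 : R) 1 (discr_root p q) ((p + q) / (p - q)).
Proof.
move=> qp; have pq0 : 0 < p - q by rewrite subr_gt0.
pose g s := (p + q + s) ^+ 2 - 4 * p * q.
have g0 : g 0 = (p - q) ^+ 2 by rewrite /g; ring.
have dg : is_derive (0 : R) 1 g (2 * (p + q)).
  have h1 := is_deriveX 2 (is_derive_affine (p + q)).
  have h2 := is_deriveB h1 (is_derive_cst (4 * p * q) (0 : R) 1).
  apply: (@is_derive_eq _ _ _ _ _ _ _ _ h2).
  by rewrite /GRing.scale /=; ring.
have ds : is_derive (g 0) 1 (@Num.sqrt R) (2 * Num.sqrt (g 0))^-1.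
  by apply: is_derive1_sqrt; rewrite g0 exprn_gt0.
have h := is_derive1_comp ds dg.
apply: (@is_derive_eq _ _ _ _ _ _ _ _ h).
rewrite g0 sqrtr_sqr gtr0_norm// /GRing.scale /=.
by field; rewrite lt0r_neq0.
Qed.

Lemma decay0 p q : 0 < q -> q < p -> decay p q 0 = 1.
Proof.
by move=> q0 qp; rewrite /decay discr_root0//; field; rewrite lt0r_neq0.
Qed.

Lemma is_derive_decay p q : 0 < q -> q < p ->
  is_derive (0 : R) 1 (decay p q) (- (p - q)^-1).
Proof.
move=> q0 qp; have pq0 : 0 < p - q by rewrite subr_gt0.
have h1 := is_deriveB (is_derive_affine (p + q)) (is_derive_discr_root qp).
have h := is_deriveM h1 (is_derive_cst (2 * q)^-1 (0 : R) 1).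
apply: (@is_derive_eq _ _ _ _ _ _ _ _ h).
rewrite /GRing.scale /=; field.
by rewrite !lt0r_neq0.
Qed.

Lemma is_derive_discr_rootV p q : q < p ->
  is_derive (0 : R) 1 (fun s => (discr_root p q s)^-1)
    (- ((p + q) / (p - q) ^+ 3)).
Proof.
move=> qp; have pq0 : 0 < p - q by rewrite subr_gt0.
have D0 : discr_root p q 0 != 0 by rewrite discr_root0// lt0r_neq0.
have h := is_deriveV D0 (is_derive_discr_root qp).
apply: (@is_derive_eq _ _ _ _ _ _ _ _ h).
rewrite /GRing.scale /= discr_root0//; field.
by rewrite lt0r_neq0.
Qed.

(** Serves both sides of the origin, since the decay rates on the two sides
    differ by the constant factor [q / p]. *)
Lemma green_expansion p q (k : nat) : 0 < q -> q < p ->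
  exists2 e : R -> R, e =o_ (0^'+) (fun s : R => s) &
    forall s, decay p q s ^+ k / discr_root p q s =
      (1 - (k%:R / (p - q) + (p + q) / (p - q) ^+ 2) * s + e s) / (p - q).
Proof.
move=> q0 qp; have pq0 : 0 < p - q by rewrite subr_gt0.
pose G s := (p - q) * (decay p q s ^+ k / discr_root p q s).
have G0 : G 0 = 1.
  by rewrite /G decay0// discr_root0// expr1n mul1r mulfV// lt0r_neq0.
have dG : is_derive (0 : R) 1 G
    (- (k%:R / (p - q) + (p + q) / (p - q) ^+ 2)).
  have dX : is_derive (0 : R) 1 (fun s => decay p q s ^+ k)
      (k%:R * decay p q 0 ^+ k.-1 *: - (p - q)^-1).
    rewrite (_ : (fun s => _) = decay p q ^+ k); last first.
      by apply/funext => s; rewrite exprfctE.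
    exact: is_deriveX (is_derive_decay q0 qp).
  have h1 := is_deriveM dX
    (is_derive_discr_rootV qp).
  have h := is_deriveM (is_derive_cst (p - q) (0 : R) 1) h1.
  apply: (@is_derive_eq _ _ _ _ _ _ _ _ h).
  rewrite /GRing.scale /= decay0// discr_root0// !expr1n; field.
  by rewrite lt0r_neq0.
exists (fun s => G s - G 0 - - (k%:R / (p - q) + (p + q) / (p - q) ^+ 2) * s).
  exact: is_derive_littleo.
move=> s; rewrite G0.
have -> : decay p q s ^+ k / discr_root p q s = G s / (p - q).
  by rewrite /G mulrAC mulfV ?mul1r ?lt0r_neq0.
by congr (_ / _); ring.
Qed.

(** With [D = discr_root p q s], the left-hand side of the second conclusion
    equals [2 q s / (D (D + p - q + s))], by
    [D^2 - (p - q + s)^2 = 4 q s]; this isolates the factor [s] from a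
    differentiable function. *)
Lemma left_mass_expansion p q : 0 < q -> q < p ->
  exists2 e : R -> R, e =o_ (0^'+) (fun s : R => s) &
    forall s, 0 < s -> (discr_root p q s + q - p - s) / (2 * discr_root p q s) =
      q * s / (p - q) ^+ 2 * (1 - (2 * p + q) / (p - q) ^+ 2 * s + e s).
Proof.
move=> q0 qp; have pq0 : 0 < p - q by rewrite subr_gt0.
pose A s := discr_root p q s + (p - q + s).
pose G s := 2 * (p - q) ^+ 2 * ((discr_root p q s)^-1 * (A s)^-1).
have A0 : A 0 = 2 * (p - q) by rewrite /A discr_root0//; ring.
have dA : is_derive (0 : R) 1 A ((p + q) / (p - q) + 1).
  exact: is_deriveD (is_derive_discr_root qp) (is_derive_affine (p - q)).
have A0n : A 0 != 0 by rewrite A0 lt0r_neq0// mulr_gt0.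
have G0 : G 0 = 1.
  by rewrite /G A0 discr_root0//; field; rewrite lt0r_neq0.
have dG : is_derive (0 : R) 1 G (- ((2 * p + q) / (p - q) ^+ 2)).
  have h1 := is_deriveM (is_derive_discr_rootV qp) (is_deriveV A0n dA).
  have h := is_deriveM (is_derive_cst (2 * (p - q) ^+ 2) (0 : R) 1) h1.
  apply: (@is_derive_eq _ _ _ _ _ _ _ _ h).
  rewrite /GRing.scale /= discr_root0// A0; field.
  by rewrite lt0r_neq0.
exists (fun s => G s - G 0 - - ((2 * p + q) / (p - q) ^+ 2) * s).
  exact: is_derive_littleo.
move=> s s0; rewrite G0.
have -> : 1 - (2 * p + q) / (p - q) ^+ 2 * s +
  (G s - 1 - - ((2 * p + q) / (p - q) ^+ 2) * s) = G s by ring.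
rewrite /G /A; have p0 := lt_trans q0 qp.
have E := discr_rootK p0 q0 s0; have D0 := discr_root_gt0 p0 q0 s0.
set D := discr_root p q s in E D0 *.
have B0 : 0 < D + (p - q + s) by rewrite addr_gt0 // addr_gt0.
apply/eqP; rewrite -subr_eq0.
(* The difference of both sides is a multiple of the discriminant identity. *)
have -> : (D + q - p - s) / (2 * D) -
    q * s / (p - q) ^+ 2 * (2 * (p - q) ^+ 2 * (D^-1 * (D + (p - q + s))^-1)) =
    (D ^+ 2 - ((p + q + s) ^+ 2 - 4 * p * q)) / (2 * D * (D + (p - q + s))).
  by field; rewrite !lt0r_neq0.
by rewrite E subrr mul0r.
Qed.

Lemma right_mass_expansion p q : 0 < q -> q < p ->
  exists2 e : R -> R, e =o_ (0^'+) (fun s : R => s) &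
    forall s, 0 < s -> (discr_root p q s + p - q - s) / (2 * discr_root p q s) =
      1 - p * s / (p - q) ^+ 2 + e s.
Proof.
move=> q0 qp; have pq0 : 0 < p - q by rewrite subr_gt0.
pose H s := 2^-1 + ((p - q - s) / 2) * (discr_root p q s)^-1.
have H0 : H 0 = 1 by rewrite /H discr_root0//; field; rewrite lt0r_neq0.
have dH : is_derive (0 : R) 1 H (- (p / (p - q) ^+ 2)).
  have h1 :=
    is_deriveB (is_derive_cst (p - q) (0 : R) 1) (is_derive_id (0 : R) 1).
  have h2 := is_deriveM h1 (is_derive_cst (2^-1 : R) (0 : R) 1).
  have h3 := is_deriveM h2 (is_derive_discr_rootV qp).
  have h := is_deriveD (is_derive_cst (2^-1 : R) (0 : R) 1) h3.
  apply: (@is_derive_eq _ _ _ _ _ _ _ _ h).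
  rewrite /GRing.scale !fctE /= discr_root0//. field.
  by rewrite lt0r_neq0.
exists (fun s => H s - H 0 - - (p / (p - q) ^+ 2) * s).
  exact: is_derive_littleo.
move=> s s0; rewrite H0 /H.
have D0 := discr_root_gt0 (lt_trans q0 qp) q0 s0.
by field; rewrite !lt0r_neq0.
Qed.

(** For [p = q] the discriminant factors as [s * (s + 4 * p)]. *)
Lemma origin_mass_expansion_symmetric p : 0 < p ->
  exists2 e : R -> R, e =o_ (0^'+) (fun s : R => Num.sqrt s) &
    forall s, 0 < s -> s / discr_root p p s = 1 / 2 * Num.sqrt (s / p) + e s.
Proof.
move=> p0.
pose f s := (Num.sqrt (s + 4 * p))^-1 - (Num.sqrt (4 * p))^-1.
have f0 : f s @[s --> (0 : R)^'+] --> (0 : R).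
  rewrite -[X in _ --> X](subrr (Num.sqrt (4 * p))^-1); apply: cvgB; last first.
    exact: cvg_cst.
  apply: cvgV; first by rewrite sqrtr_eq0 -ltNge mulr_gt0.
  apply: cvg_at_right_filter; rewrite -{2}[4 * p]add0r.
  apply: (@continuous_comp _ _ _ (fun s => s + 4 * p) (@Num.sqrt R)).
    by apply: cvgD; [exact: cvg_id|exact: cvg_cst].
  exact: sqrt_continuous.
exists (fun s => Num.sqrt s * f s); first exact: cvg0_littleo_sqrt.
move=> s s0.
have -> : discr_root p p s = Num.sqrt s * Num.sqrt (s + 4 * p).
  by rewrite -sqrtrM ?ltW// /discr_root; congr Num.sqrt; ring.
have s4 : Num.sqrt (4 * p) = 2 * Num.sqrt p.
  by rewrite sqrtrM// -[4]/((2 * 2)%:R) natrM -expr2 sqrtr_sqr ger0_norm.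
rewrite sqrtrM ?ltW// sqrtrV ?ltW// /f s4.
rewrite -{1}(sqr_sqrtr (ltW s0)).
field; rewrite !lt0r_neq0 ?sqrtr_gt0// ?addr_gt0 ?mulr_gt0//.
Qed.

End SmallAbsorption.

Theorem theorem7 (R : realType) (p q : R)
    (d : R -> measure_display) (T : forall s : R, measurableType (d s))
    (P : forall s : R, probability (T s) R)
    (X : forall s : R, nat -> T s -> walk_state)
    (hp : 0 < p) (hq : 0 < q) (hpq : p + q < 1)
    (hX : forall s : R, 0 < s -> s <= 1 - p - q ->
       pqrs_walk p q (1 - p - q - s) s 0 (P s) (X s)) :
  let sx := fun (s : R) (n : int) => (s%:E * expected_visits (P s) (X s) n)%E in
  let sxl := fun s : R => (\sum_(1 <= k <oo) sx s (- k%:Z)%R)%E in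
  let sxr := fun s : R => (\sum_(1 <= k <oo) sx s k%:Z)%E in
  (forall (s : R) (n : int), 0 < s -> s <= 1 - p - q ->
     P s [set w | exists t : nat, X s t w = Absorbed n] = sx s n) /\
  (q < p ->
     (forall n : int, 0 <= n ->
        exists2 e : R -> R, e =o_ (0^'+) (fun s : R => s) &
          \forall s \near 0^'+,
            fine (sx s n) = s / (p - q) *
              (1 - (n%:~R / (p - q) + (p + q) / (p - q) ^+ 2) * s + e s)) /\
     (forall n : int, n <= 0 ->
        exists2 e : R -> R, e =o_ (0^'+) (fun s : R => s) &
          \forall s \near 0^'+,
            fine (sx s n) = (p / q) ^ n * s / (p - q) *
              (1 - (- n%:~R / (p - q) + (p + q) / (p - q) ^+ 2) * s + e s)) /\
     (exists2 e : R -> R, e =o_ (0^'+) (fun s : R => s) &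
        \forall s \near 0^'+,
          fine (sxl s) = q * s / (p - q) ^+ 2 *
            (1 - (2 * p + q) / (p - q) ^+ 2 * s + e s)) /\
     (exists2 e : R -> R, e =o_ (0^'+) (fun s : R => s) &
        \forall s \near 0^'+,
          fine (sxr s) = 1 - p * s / (p - q) ^+ 2 + e s)) /\
  (p = q ->
     (forall s : R, 0 < s -> s <= 1 - p - q -> sxr s = sxl s) /\
     (exists2 e : R -> R, e =o_ (0^'+) (fun s : R => Num.sqrt s) &
        \forall s \near 0^'+,
          fine (sxl s) = 1 / 2 - 1 / 4 * Num.sqrt (s / p) + e s) /\
     (exists2 e : R -> R, e =o_ (0^'+) (fun s : R => Num.sqrt s) &
        \forall s \near 0^'+,
          fine (sx s 0) = 1 / 2 * Num.sqrt (s / p) + e s)).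
Proof.
move=> sx sxl sxr.
have abs s n : 0 < s -> s <= 1 - p - q ->
    P s [set w | exists t : nat, X s t w = Absorbed n] = sx s n.
  move=> s0 s1; have r0 : 0 <= 1 - p - q - s by rewrite subr_ge0.
  exact: (absorption_prob (ltW hp) (ltW hq) r0 (ltW s0) (hX s s0 s1) s0 n).
have sxE s n : 0 < s -> s <= 1 - p - q -> sx s n = (s * green p q s n)%:E.
  by move=> s0 s1; rewrite /sx (expected_visits_green hp hq s0 s1 (hX s s0 s1)).
have sxlE s : 0 < s -> s <= 1 - p - q -> sxl s =
    ((discr_root p q s + q - p - s) / (2 * discr_root p q s))%:E.
  move=> s0 s1; rewrite -green_left_sum//.
  by apply: eq_eseriesr => k _; rewrite sxE.
have sxrE s : 0 < s -> s <= 1 - p - q -> sxr s =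
    ((discr_root p q s + p - q - s) / (2 * discr_root p q s))%:E.
  move=> s0 s1; rewrite -green_right_sum//.
  by apply: eq_eseriesr => k _; rewrite sxE.
have small (Q : R -> Prop) : (forall s, 0 < s -> s <= 1 - p - q -> Q s) ->
    \forall s \near 0^'+, Q s.
  move=> HQ; near=> s; apply: HQ; first by [].
  by near: s; apply: nbhs_right_le; rewrite -addrA -opprD subr_gt0.
split=> //; split=> [qp|pq].
  split; [|split; [|split]].
  - case=> // k _; have [e oe E] := green_expansion k hq qp.
    exists e => //; apply: small => s s0 s1.
    by rewrite sxE//= E; ring.
  - move=> n n0; have [k ->] : exists k : nat, n = - k%:Z by exists `|n|%N; lia.
    have [e oe E] := green_expansion k hq qp.
    exists e => //; apply: small => s s0 s1.
    rewrite sxE// -greenN opprK /= discr_rootC.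
    have -> : decay q p s = (p / q)^-1 * decay p q s.
      by rewrite /decay discr_rootC; field; rewrite !lt0r_neq0.
    have -> : (p / q) ^ (- k%:Z) = (p / q)^-1 ^+ k by rewrite -exprz_inv.
    by rewrite exprMn -[X in s * X]mulrA E mulrNz opprK; ring.
  - have [e oe E] := left_mass_expansion hq qp.
    by exists e => //; apply: small => s s0 s1; rewrite sxlE//= E.
  - have [e oe E] := right_mass_expansion hq qp.
    by exists e => //; apply: small => s s0 s1; rewrite sxrE//= E.
subst q.
have [e oe E] := origin_mass_expansion_symmetric hp.
split; [|split].
- by move=> s s0 s1; rewrite sxlE// sxrE.
(* By symmetry the left mass is half of what the origin leaves. *)
- exists (fun s => - (e s / 2)).
    apply/eqoP => eps eps0; move/eqoP : oe => /(_ _ eps0).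
    apply: filterS => s; apply: le_trans; rewrite normrN normrM.
    by rewrite ler_piMr// ger0_norm ?invr_ge0// invf_le1// ler1n.
  apply: small => s s0 s1; rewrite sxlE//=.
  have D0 := discr_root_gt0 hp hp s0.
  have -> : (discr_root p p s + p - p - s) / (2 * discr_root p p s) =
    1 / 2 - (s / discr_root p p s) / 2 by field; rewrite lt0r_neq0.
  by rewrite E//; field.
- exists e => //; apply: small => s s0 s1.
  by rewrite sxE//= expr0 mul1r E.
Unshelve. all: by end_near. Qed.
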